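(* Let $d\geq 1$ and let $f:\mathbb{R}_+^d\to\mathbb{R}$ be a Lebesgue measurable componentwise subadditive function. Then the simultaneous limit of $\dfrac{f(x_1,\ldots,x_d)}{x_1\cdots x_d}$ over the directed set $\mathcal{R}_+^d$ exists in $[-\infty,+\infty)$ and $$\lim_{(x_1,\ldots,x_d)\to\mathcal{R}_+^d}\frac{f(x_1,\ldots,x_d)}{x_1\cdots x_d}=\inf_{x_1,\ldots,x_d\in\mathbb{R}_+}\frac{f(x_1,\ldots,x_d)}{x_1\cdots x_d},$$ where the common value can be $-\infty$. In addition, for every permutation $\sigma$ of $\{1,\ldots,d\}$, the iterated limit below exists and $$\lim_{x_{\sigma(1)}\to+\infty}\ldots\lim_{x_{\sigma(d)}\to+\infty}\frac{f(x_1,\ldots,x_d)}{x_1\cdots x_d}=\lim_{(x_1,\ldots,x_d)\to\mathcal{R}_+^d}\frac{f(x_1,\ldots,x_d)}{x_1\cdots x_d},$$ regardless of any of the limits being finite or (negatively) infinite.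
   Context: $\mathbb{R}_+$ is the set of positive real numbers (zero excluded), an additive semigroup. A function $g$ on an additive semigroup $S$ is subadditive if $g(x+y)\leq g(x)+g(y)$ for all $x,y\in S$. A function $f$ on a product $S_1\times\cdots\times S_d$ of semigroups is componentwise subadditive if, for every $i\in\{1,\ldots,d\}$ and every fixed choice of $x_j\in S_j$ for all $j\neq i$, the function $x_i\mapsto f(x_1,\ldots,x_i,\ldots,x_d)$ is subadditive on $S_i$. $\mathcal{R}_+^d$ denotes the set $\mathbb{R}_+^d$ directed by the product order: $(x_1,\ldots,x_d)\leq_\Pi(y_1,\ldots,y_d)$ iff $x_i\leq y_i$ for every $i$. For a function $g$ on a directed set $\mathcal{U}=(U,\preceq)$, $\liminf_{x\to\mathcal{U}}g(x)=\sup_{x\in U}\inf_{y\succeq x}g(y)$ and $\limsup_{x\to\mathcal{U}}g(x)=\inf_{x\in U}\sup_{y\succeq x}g(y)$; the limit $\lim_{x\to\mathcal{U}}g(x)$ is their common value (possibly infinite) when they coincide. In the iterated limit, the innermost limit (in $x_{\sigma(d)}$, the other variables being fixed) is taken first, and so on outward; intermediate limits are allowed to take the value $-\infty$. *)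

(* Defs.v *)
From HB Require Import structures.
From mathcomp Require Import all_boot all_order all_algebra all_fingroup.
From mathcomp Require Import all_classical all_reals all_analysis.

Set Implicit Arguments.
Unset Strict Implicit.
Unset Printing Implicit Defensive.

Import Order.TTheory GRing.Theory Num.Theory.
Import numFieldNormedType.Exports.

Local Open Scope classical_set_scope.
Local Open Scope ring_scope.

(* Points of R^d are functions ['I_d -> R], and a function on a subset D of R^d
   is a total function of which only the values on D are ever used.
   [dfwith x i t] is the point x with its i-th coordinate replaced by t. *)

Definition pos_reals (R : realType) : set R := [set t | 0 < t].

Definition orthant (R : realType) (d : nat) : set ('I_d -> R) :=
  [set x | forall i, pos_reals (x i)].

Definition subadditive_on (R : realType) (V : nmodType) (S : set V)
    (g : V -> R) : Prop :=
  forall x y, S x -> S y -> g (x + y) <= g x + g y.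

Definition componentwise_subadditive (R : realType) (V : nmodType) (d : nat)
    (S : 'I_d -> set V) (f : ('I_d -> V) -> R) : Prop :=
  forall (i : 'I_d) (x : 'I_d -> V), (forall j, j != i -> S j (x j)) ->
    subadditive_on (S i) (fun t => f (dfwith x i t)).

Definition closed_box (R : realType) (d : nat) (a b : 'I_d -> R) :
    set ('I_d -> R) :=
  [set x | forall i, x i \in `[a i, b i]].

(* Covers by countably many closed boxes; degenerate boxes are allowed. *)
Definition lebesgue_outer_measure (R : realType) (d : nat)
    (A : set ('I_d -> R)) : \bar R :=
  ereal_inf [set (\sum_(0 <= k <oo) (\prod_(i < d) (c.2 k i - c.1 k i))%:E)%E
            | c in [set c : (nat -> 'I_d -> R) * (nat -> 'I_d -> R) |
                 (forall k i, c.1 k i <= c.2 k i) /\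
                 A `<=` \bigcup_k closed_box (c.1 k) (c.2 k)]].

Definition lebesgue_measurable_set (R : realType) (d : nat)
    (A : set ('I_d -> R)) : Prop :=
  (@lebesgue_outer_measure R d).-caratheodory A.

(* The codomain carries the Borel sigma-algebra. *)
Definition lebesgue_measurable_fun (R : realType) (d : nat)
    (D : set ('I_d -> R)) (f : ('I_d -> R) -> R) : Prop :=
  forall B : set R, measurable B -> lebesgue_measurable_set (D `&` f @^-1` B).

Definition le_prod (R : realType) (d : nat) (x y : 'I_d -> R) : Prop :=
  forall i, x i <= y i.

Section directed_limits.
Variables (R : realType) (T : Type) (U : set T) (le : T -> T -> Prop).
Implicit Type g : T -> \bar R.

Definition dir_liminf g : \bar R :=
  ereal_sup [set ereal_inf [set g y | y in [set y | U y /\ le x y]] | x in U].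

Definition dir_limsup g : \bar R :=
  ereal_inf [set ereal_sup [set g y | y in [set y | U y /\ le x y]] | x in U].

Definition is_dir_lim g (l : \bar R) : Prop :=
  dir_liminf g = l /\ dir_limsup g = l.

End directed_limits.

(* [is_iterated_lim s g x l] says that, for s = [:: i_1; ...; i_k],
     lim_(x_(i_1) --> +oo) ... lim_(x_(i_k) --> +oo) g x
   exists and equals l, the innermost limit being the one in x_(i_k) and the
   coordinates not listed in s being those of x.  Each limit must exist, in
   [-oo, +oo), for all positive values of the variables outside it. *)
Fixpoint is_iterated_lim (R : realType) (d : nat) (s : seq 'I_d)
    (g : ('I_d -> R) -> \bar R) (x : 'I_d -> R) (l : \bar R) : Prop :=
  if s is i :: s' then
    (l < +oo)%E /\
    exists h : R -> \bar R,
      (forall t, pos_reals t -> is_iterated_lim s' g (dfwith x i t) (h t)) /\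
      h t @[t --> +oo] --> l
  else g x = l.

Definition quot_prod (R : realType) (d : nat) (f : ('I_d -> R) -> R)
    (x : 'I_d -> R) : \bar R :=
  (f x / \prod_(i < d) x i)%:E.

(* Main.v *)
From HB Require Import structures.
Require Import Defs.
From mathcomp Require Import all_boot all_order all_algebra all_fingroup.
From mathcomp Require Import all_classical all_reals all_analysis.
From mathcomp Require Import measurable_realfun ring lra.

Set Implicit Arguments.
Unset Strict Implicit.
Unset Printing Implicit Defensive.

Import Order.TTheory GRing.Theory Num.Theory.
Import numFieldNormedType.Exports.

Local Open Scope classical_set_scope.
Local Open Scope ring_scope.

(** Write q for the function f(x) / (x_1 ... x_d) on the open orthant, and L
for its infimum.  The inequality q >= L is trivial, so everything amounts to an
upper bound: q(x) must be nearly as small as any given value q(y) once the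
coordinates of x are large.

Local boundedness.  Measurability serves only to show that f is bounded above
on every box [a, b] with 0 < a.  Let 0 < x < t.  Splitting t_i as
x_i + (t_i - x_i) in every coordinate bounds f t by a sum of 2^d values of f at
points z with z_i = x_i or z_i = t_i - x_i, so one of these values is at least
f t / 2^d.  Hence, if f t > 2^d N, the box (0, t) is covered by 2^d reflected
copies of the part of (0, t) where f > N, and that part has outer measure at
least (t_1 ... t_d) / 2^d >= (a_1 ... a_d) / 2^d.  But the sets {f >= N} are
measurable and decrease to the empty set, so the outer measures of their parts
in the bounded box (0, b) tend to 0, and for N large no t in [a, b] can satisfy
f t > 2^d N ([componentwise_subadditive_bounded]).  The argument uses f on the
whole orthant, and that is essential for the iterated limits: the sections of f
need not be measurable, but they inherit the local bound.

The upper bound.  Write x_i = n y_i + z with y_i <= z <= 2 y_i.  Subadditivity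
in the i-th coordinate makes q(x) at most a convex combination of the values of
q where x_i is replaced by y_i and by z, the second weight being z / x_i
([density_convex]).  Doing this in all coordinates shows first that q on the
whole region x >= y is bounded by its bound M on the box [y, 2y], and then that
q(x) <= q(y) + 2 (M - q(y)) sum y_i / x_i, where the sum is over the coordinates
in which x and y differ ([density_approx]).

The limits.  With all coordinates going to infinity this gives limsup q <= q(y)
for every y, which is the simultaneous limit ([quot_prod_dir_lim]).  With a
single coordinate moving it identifies each intermediate limit as the infimum
of q over the variables already sent to infinity, the others being fixed
([quot_prod_iterated_lim]); since all estimates are for the real-valued q,
intermediate limits equal to -oo cause no difficulty. *)

(** * Volume of a covered box *)

(** Slicing replaces the usual compactness argument.  For each value t of the
first coordinate, the boxes whose first side contains t cover the slice, so by
induction their cross-sections have total volume at least that of the slice;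
integrating over t, termwise by monotone convergence, turns the indicator of
each first side into its length.  The predicate K, which selects the boxes in
use, is what makes this induction possible. *)
Lemma box_volume_le_cover (R : realType) (I : eqType) (a : I -> R)
    (c e : nat -> I -> R) (s : seq I) (K : pred nat) :
  uniq s -> (forall i, 0 <= a i) -> (forall k i, c k i <= e k i) ->
  (forall x : I -> R, (forall i, i \in s -> 0 < x i < a i) ->
     exists2 k, K k & forall i, i \in s -> c k i <= x i <= e k i) ->
  ((\prod_(i <- s) a i)%:E <=
   \sum_(0 <= k <oo | K k) (\prod_(i <- s) (e k i - c k i))%:E)%E.
Proof.
move=> + a0 ce; elim: s K => [|i s IHs] K /=.
  move=> _ /(_ a)[//|k Kk _]; rewrite big_nil.
  under eq_eseriesr do rewrite big_nil.
  rewrite (nneseriesD1 _ Kk)// leeDl//; exact: nneseries_ge0.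
move=> /andP[iNs us] cov.
pose v k := \prod_(j <- s) (e k j - c k j).
have v0 k : 0 <= v k by rewrite prodr_ge0// => j _; rewrite subr_ge0.
pose D : set R := `]0, a i[%classic.
pose J k : set R := `[c k i, e k i]%classic.
pose F k (t : R) := (if K k then (v k * \1_(J k) t)%:E else 0)%E.
have F0 k t : (0 <= F k t)%E.
  by rewrite /F; case: ifP => // _; rewrite lee_fin mulr_ge0.
have mJ k : measurable (J k) by exact: measurable_itv.
have mD : measurable D by exact: measurable_itv.
have mF k : measurable_fun D (F k).
  rewrite /F; case: (K k) => //.
  apply/measurable_EFinP; apply: measurable_funM => //.
have slice t : D t -> ((\prod_(j <- s) a j)%:E <= \sum_(0 <= k <oo) F k t)%E.
  rewrite /D /= in_itv/= => Dt.
  have -> : (\sum_(0 <= k <oo) F k t =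
             \sum_(0 <= k <oo | K k && (t \in J k)) (v k)%:E)%E.
    rewrite eseries_mkcondr [RHS]eseries_mkcond; apply: eq_eseriesr => k _.
    rewrite /F indicE; case: (K k) => //.
    by case: (t \in J k); rewrite ?mulr1 ?mulr0.
  apply: (IHs (fun k => K k && (t \in J k))) => // x xs.
  (* The point x of the slice, put back at height t in the box. *)
  have [|k Kk xk] := cov (dfwith x i t).
    move=> j; rewrite inE => /orP[/eqP ->|js]; first by rewrite dfwithin.
    by rewrite dfwithout ?xs//; apply: contraNneq iNs => ->.
  exists k.
    rewrite Kk /= inE /J /= in_itv/=.
    by have := xk i; rewrite inE eqxx dfwithin => /(_ isT).
  move=> j js; have := xk j; rewrite inE js orbT dfwithout; first exact.
  by apply: contraNneq iNs => ->.
have muI (x y : R) : x <= y ->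
    lebesgue_measure (`[x, y]%classic : set R) = (y - x)%:E.
  move=> xy; rewrite lebesgue_measure_itv/= lte_fin; case: ltP => // yx.
  by have -> : y = x by [lra]; rewrite subrr.
have muD : lebesgue_measure D = (a i)%:E.
  rewrite lebesgue_measure_itv/= lte_fin oppr0 adde0; case: ltP => // ai.
  by congr EFin; apply/le_anti; rewrite a0 ai.
have -> : (\prod_(j <- i :: s) a j)%:E =
    (\int[lebesgue_measure]_(t in D) (\prod_(j <- s) a j)%:E)%E.
  have -> := integral_cst lebesgue_measure mD (\prod_(j <- s) a j)%:E.
  by rewrite big_cons mulrC EFinM -muD.
apply: (@le_trans _ _
  (\int[lebesgue_measure]_(t in D) (\sum_(0 <= k <oo) F k t))%E).
  apply: ge0_le_integral => //=.
  - by move=> t Dt; rewrite lee_fin prodr_ge0.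
  - apply: ge0_emeasurable_sum => [k t _ _|k _];
      [exact: F0|exact: mF].
rewrite integral_nneseries//= [leRHS]eseries_mkcond.
apply: lee_nneseries => [k _ _|k _]; first exact: integral_ge0.
rewrite /F big_cons -/(v k); case: (K k); last by rewrite integral0.
have -> : (\int[lebesgue_measure]_(t in D) (v k * \1_(J k) t)%:E =
    (v k)%:E * lebesgue_measure (J k `&` D))%E.
  transitivity ((v k)%:E *
      \int[lebesgue_measure]_(t in D) (\1_(J k) t)%:E)%E.
    apply: (@integralZl_indic _ (measurableTypeR R) R lebesgue_measure D mD
      (fun=> J k) (v k)); last exact: mJ.
    by rewrite ltNge v0.
  have -> // := @integral_indic _ (measurableTypeR R) R lebesgue_measure D mD
    (J k) (mJ k).
rewrite mulrC EFinM lee_pmul// ?lee_fin//.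
rewrite -muI//; apply: (@le_measure _ (measurableTypeR R)); rewrite ?inE//.
by apply: measurableI; [exact: mJ|exact: mD].
Qed.

(** * The Lebesgue outer measure *)
Lemma dfwithE (I : eqType) (T : Type) (x : I -> T) (i : I) (t : T) (j : I) :
  dfwith x i t j = if i == j then t else x j.
Proof. by case: eqVneq => [<-|ij]; rewrite ?dfwithin ?dfwithout. Qed.

Lemma lebesgue_outer_measure_le_cover (R : realType) (d : nat)
    (A : set ('I_d -> R)) (c e : nat -> 'I_d -> R) :
  (forall k i, c k i <= e k i) -> A `<=` \bigcup_k closed_box (c k) (e k) ->
  (lebesgue_outer_measure A <=
   \sum_(0 <= k <oo) (\prod_(i < d) (e k i - c k i))%:E)%E.
Proof. by move=> ce Ace; apply: ereal_inf_lbound; exists (c, e). Qed.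

Lemma box_volume_ge0 (R : realType) (d : nat) (c e : 'I_d -> R) :
  (forall i, c i <= e i) -> 0 <= \prod_(i < d) (e i - c i).
Proof. by move=> ce; apply: prodr_ge0 => i _; rewrite subr_ge0. Qed.

Lemma lebesgue_outer_measure_closed_box (R : realType) (n : nat)
    (a b : 'I_n.+1 -> R) : (forall i, a i <= b i) ->
  (lebesgue_outer_measure (closed_box a b) <=
   (\prod_(i < n.+1) (b i - a i))%:E)%E.
Proof.
move=> ab; pose e k : 'I_n.+1 -> R := if k is 0%N then b else a.
have ae k i : a i <= e k i by case: k => /=.
apply: (le_trans (@lebesgue_outer_measure_le_cover R n.+1 _ (fun=> a) e ae _)).
  by move=> x abx; exists 0%N.
rewrite nneseries_recl//; last by move=> k _; rewrite lee_fin box_volume_ge0.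
rewrite eseries0 ?adde0// => -[//|k] _ _ /=.
by rewrite (bigD1 ord0)//= subrr mul0r.
Qed.

(** The dimension is positive here because the product over no coordinate is
1: in dimension 0 even a degenerate box has volume 1. *)
Lemma lebesgue_outer_measure0 (R : realType) (n : nat) :
  @lebesgue_outer_measure R n.+1 set0 = 0%E.
Proof.
apply/eqP; rewrite eq_le; apply/andP; split; last first.
  apply: le_ereal_inf_tmp => _ [c [cle _] <-].
  by apply: nneseries_ge0 => k _ _; rewrite lee_fin box_volume_ge0.
apply: (le_trans (@lebesgue_outer_measure_le_cover R n.+1 _
  (fun _ _ => 0) (fun _ _ => 0) _ _)) => //.
rewrite eseries0// => k _ _ /=.
by rewrite (bigD1 ord0)//= subrr mul0r.
Qed.

Lemma lebesgue_outer_measure_ge0 (R : realType) (d : nat)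
  (A : set ('I_d -> R)) : (0 <= lebesgue_outer_measure A)%E.
Proof.
apply: le_ereal_inf_tmp => _ [c [cle _] <-].
by apply: nneseries_ge0 => k _ _; rewrite lee_fin box_volume_ge0.
Qed.

Lemma le_lebesgue_outer_measure (R : realType) (d : nat) :
  {homo @lebesgue_outer_measure R d : A B / A `<=` B >-> (A <= B)%E}.
Proof.
move=> A B AB; apply: le_ereal_inf_tmp => _ [c [cle Bc] <-].
by apply: lebesgue_outer_measure_le_cover => //; exact: subset_trans Bc.
Qed.

(** Choose for each A n a cover that is optimal up to e / 2^(n+1), and enumerate
all the boxes of all the covers along a bijection of nat with nat * nat. *)
Lemma lebesgue_outer_measure_sigma_subadditive (R : realType) (d : nat) :
  sigma_subadditive (@lebesgue_outer_measure R d).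
Proof.
move=> A; set mu := @lebesgue_outer_measure R d.
have mu0 B : (0 <= mu B)%E by exact: lebesgue_outer_measure_ge0.
have [[i ioo]|] := pselect (exists i, mu (A i) = +oo%E).
  rewrite (eseries_pinfty _ _ ioo) ?leey// => n _.
  by rewrite -ltNye (lt_le_trans _ (mu0 _)).
rewrite -forallNE => Aoo.
suff add2e (e : {posnum R}) :
    (mu (\bigcup_n A n) <= \sum_(i <oo) mu (A i) + e%:num%:E)%E.
  by apply/lee_addgt0Pr => _/posnumP[].
rewrite (le_trans _ (epsilon_trick _ _ _))//.
pose vol (c : (nat -> 'I_d -> R) * (nat -> 'I_d -> R)) k : \bar R :=
  (\prod_(i < d) (c.2 k i - c.1 k i))%:E.
pose P n (c : (nat -> 'I_d -> R) * (nat -> 'I_d -> R)) :=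
  [/\ forall k i, c.1 k i <= c.2 k i,
      A n `<=` \bigcup_k closed_box (c.1 k) (c.2 k) &
      (\sum_(0 <= k <oo) vol c k <= mu (A n) + (e%:num / (2 ^ n.+1)%:R)%:E)%E].
have [G PG] : {G : nat -> (nat -> 'I_d -> R) * (nat -> 'I_d -> R) &
    forall n, P n (G n)}.
  apply: (@choice _ _ P) => n; rewrite /P.
  have fin : mu (A n) \is a fin_num.
    by rewrite ge0_fin_numE// ltey; apply/eqP; exact: Aoo.
  have en1 : 0 < e%:num / (2 ^ n.+1)%:R :> R by [].
  have [_ [c [cle Ac] <-] cmu] := lb_ereal_inf_adherent en1 fin.
  by exists c; split => //; exact/ltW.
have vol0 n k : (0 <= vol (G n) k)%E.
  by rewrite lee_fin box_volume_ge0// => i; have [+ _ _] := PG n; exact.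
have /card_esym/ppcard_eqP[g] := card_nat2.
pose h k := vol (G (g k).1) (g k).2.
apply: (@le_trans _ _ (\sum_(0 <= k <oo) h k)%E).
  apply: (@lebesgue_outer_measure_le_cover R d _
    (fun k => (G (g k).1).1 (g k).2) (fun k => (G (g k).1).2 (g k).2)).
    by move=> k i; have [+ _ _] := PG (g k).1; exact.
  move=> x [n _ Anx]; have [_ /(_ x Anx)[k _ xk] _] := PG n.
  by exists (g^-1%FUN (n, k)) => //=; rewrite invK ?inE.
have -> : (\sum_(0 <= k <oo) h k =
           \sum_(0 <= n <oo) \sum_(0 <= k <oo) vol (G n) k)%E.
  rewrite nneseries_esumT; last by move=> k; exact: vol0.
  rewrite nneseries_esumT; last by move=> n; exact: nneseries_ge0.
  under [RHS]eq_esum => n _ do rewrite nneseries_esumT//.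
  rewrite esum_esum//.
  rewrite -(@reindex_esum _ _ _ setT (setT `*`` fun=> setT) g
    (fun k => vol (G k.1) k.2))//.
  rewrite (_ : setT `*`` _ = setT); first exact: bij.
  by apply/seteqP; split.
by apply: lee_nneseries => [n _ _|n _]; [exact: nneseries_ge0|have [] := PG n].
Qed.

HB.instance Definition _ (R : realType) (n : nat) :=
  isOuterMeasure.Build R _ (@lebesgue_outer_measure R n.+1)
    (@lebesgue_outer_measure0 R n) (@lebesgue_outer_measure_ge0 R n.+1)
    (@le_lebesgue_outer_measure R n.+1)
    (@lebesgue_outer_measure_sigma_subadditive R n.+1).

Lemma lebesgue_outer_measure_open_box (R : realType) (d : nat)
    (a : 'I_d -> R) : (forall i, 0 <= a i) ->
  ((\prod_(i < d) a i)%:E <=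
   lebesgue_outer_measure [set x | forall i, (0 < x i < a i)%R])%E.
Proof.
move=> a0; apply: le_ereal_inf_tmp => _ [[c e] /= [ce cov] <-].
apply: box_volume_le_cover => //; first exact: index_enum_uniq.
move=> x xa; have [i|k _ xk] := cov x; first by rewrite xa// mem_index_enum.
by exists k => // i _; have := xk i; rewrite in_itv.
Qed.

(** The reflection of one coordinate maps boxes to boxes of the same volume, so
it carries covers to covers. *)
Lemma lebesgue_outer_measure_reflect (R : realType) (d : nat) (i : 'I_d)
    (t : R) (A : set ('I_d -> R)) :
  (lebesgue_outer_measure [set x | A (dfwith x i (t - x i)%R)] <=
   lebesgue_outer_measure A)%E.
Proof.
apply: le_ereal_inf_tmp => _ [[c e] /= [ce cov] <-].
pose c' k := dfwith (c k) i (t - e k i).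
pose e' k := dfwith (e k) i (t - c k i).
have -> : (\sum_(0 <= k <oo) (\prod_(i0 < d) (e k i0 - c k i0))%:E =
    \sum_(0 <= k <oo) (\prod_(i0 < d) (e' k i0 - c' k i0))%:E)%E.
  apply: eq_eseriesr => k _; congr EFin; apply: eq_bigr => j _.
  by rewrite /e' /c' !dfwithE; case: eqVneq => [->|//]; ring.
apply: lebesgue_outer_measure_le_cover.
  move=> k j; rewrite /e' /c' !dfwithE; case: eqP => // _.
  by have := ce k i; lra.
move=> x /= Ax; have [k _ xk] := cov _ Ax; exists k => // j.
have := xk j; rewrite /= !in_itv/= /e' /c' !dfwithE.
case: eqVneq => // <-; lra.
Qed.

(** * Boundedness on boxes *)

(** Continuity from above for the trace on X of the measure given by mu: the
numbers mu (X `&` D k) have a sum of at most mu X, so the tails of their series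
tend to 0. *)
Lemma caratheodory_tail_lt (R : realType) (T : Type)
    (mu : {outer_measure set T -> \bar R}) (X : set T) (D : nat -> set T)
    (eps : R) : (forall k, mu.-caratheodory (D k)) -> trivIset setT D ->
  (mu X < +oo)%E -> 0 < eps ->
  exists N : nat, (mu (X `&` \bigcup_(k in ~` `I_N) D k) < eps%:E)%E.
Proof.
move=> mD tD muX eps0.
have sumfin : (\sum_(0 <= k <oo) mu (X `&` D k) < +oo)%E.
  apply: le_lt_trans muX; apply: le_trans (caratheodory_lime_le mD tD X).
  by rewrite leeDl// outer_measure_ge0.
have tail0 := nneseries_tail_cvg sumfin (fun k _ => outer_measure_ge0 mu _).
have /filter_ex[N NE] : \forall N \near \oo,
    (\sum_(N <= k <oo) mu (X `&` D k) < eps%:E)%E.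
  apply: (tail0 (fun u => u < eps%:E)%E).
  by apply: open_ereal_lt'; rewrite lte_fin.
exists N; apply: le_lt_trans NE.
by rewrite setI_bigcupr; exact: outer_measure_sigma_subadditive_tail.
Qed.

(** A corner at x, with respect to t, is a point obtained from x by reflecting
x_i to t_i - x_i for some of the coordinates i listed in s. *)
Definition corner (R : realType) (d : nat) (t : 'I_d -> R) (s : seq 'I_d)
    (x z : 'I_d -> R) : Prop :=
  forall i, if i \in s then z i = x i \/ z i = t i - x i else z i = x i.

(** One coordinate at a time: the points with a corner in A are those for which
i can be left alone, or else reflections of such points, and reflecting does not
increase the measure.  So each coordinate in s doubles the bound. *)
Lemma lebesgue_outer_measure_corner (R : realType) (n : nat)
    (t : 'I_n.+1 -> R) (s : seq 'I_n.+1) (A : set ('I_n.+1 -> R)) :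
  (lebesgue_outer_measure [set x | exists2 z, corner t s x z & A z] <=
   (2 ^+ size s)%:E * lebesgue_outer_measure A)%E.
Proof.
set mu := @lebesgue_outer_measure R n.+1.
elim: s => [|i s IHs].
  rewrite expr0 mul1e; apply: le_lebesgue_outer_measure => x [z xz Az].
  by rewrite (_ : x = z)//; apply/funext => j; have := xz j.
pose H := [set x | exists2 z, corner t s x z & A z].
pose H' := [set x | H (dfwith x i (t i - x i))].
apply: (@le_trans _ _ (mu (H `|` H'))).
  apply: le_lebesgue_outer_measure => x [z xz Az].
  have xzs j : j != i ->
      if j \in s then z j = x j \/ z j = t j - x j else z j = x j.
    by move=> /negbTE ji; have := xz j; rewrite inE ji.
  have := xz i; rewrite mem_head => -[zi|zi]; [left|right]; exists z => // j.
    have [->|/xzs//] := eqVneq j i; rewrite zi; case: ifP => // _; by left.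
  rewrite dfwithE; have [<-|ij] := eqVneq i j.
    by rewrite zi; case: ifP => // _; left.
  by apply: xzs; rewrite eq_sym.
apply: (le_trans (outer_measureU2 mu H H')).
rewrite exprS EFinM -muleA.
apply: (@le_trans _ _ (mu H + mu H)%E).
  by rewrite leeD2l//; exact: lebesgue_outer_measure_reflect.
rewrite -mule2n -mule_natl.
by rewrite lee_wpmul2l.
Qed.

(** Splitting t_i as x_i + (t_i - x_i) bounds f by a sum of two values, the
larger of which is at least half of it.  The coordinates in s have been split
already, the others are still those of t. *)
Lemma componentwise_subadditive_corner (R : realType) (d : nat)
    (f : ('I_d -> R) -> R) (t x : 'I_d -> R) (s : seq 'I_d) :
  componentwise_subadditive (fun=> @pos_reals R) f -> uniq s ->
  (forall i, 0 < x i < t i) ->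
  exists z, [/\ forall i, i \in s -> z i = x i \/ z i = t i - x i,
    forall i, i \notin s -> z i = t i & f t <= 2 ^+ size s * f z].
Proof.
move=> fsub + xt; elim: s => [|i s IHs] /=.
  by move=> _; exists t; split => //; rewrite expr0 mul1r.
move=> /andP[iNs /IHs[z [zs zNs ftz]]].
have z0 j : 0 < z j.
  have [/zs[|] ->|/zNs ->] := boolP (j \in s); have := xt j; lra.
have /(_ (x i) (t i - x i)) := fsub i z (fun j _ => z0 j).
have /andP[xi0 xit] := xt i.
rewrite subrKC (_ : dfwith z i (t i) = z); last first.
  by apply/funext => j; rewrite dfwithE; case: eqVneq => // <-; rewrite zNs.
move=> /(_ xi0); rewrite /pos_reals/= subr_gt0 => /(_ xit) fz.
have [u [ui fu]] : exists u, (u = x i \/ u = t i - x i) /\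
    f z <= 2 * f (dfwith z i u).
  have [h|h] := leP (f (dfwith z i (x i))) (f (dfwith z i (t i - x i))).
    exists (t i - x i); split; [by right|lra].
  exists (x i); split; [by left|lra].
exists (dfwith z i u); split.
- move=> j; rewrite inE dfwithE eq_sym; case: eqVneq => [<-//|_] /=.
  exact: zs.
- by move=> j; rewrite inE dfwithE eq_sym negb_or; case: eqVneq => //= _ /zNs.
- by apply: (le_trans ftz); rewrite exprSr -mulrA ler_pM2l// exprn_gt0.
Qed.

(** The layers D k = {k <= f < k+1} are disjoint, so the part of the box (0, b)
where f >= N has small measure for large N.  A point t of [a, b] with
f t > 2^d N would force this measure to be at least (a_1 ... a_d) / 2^d. *)
Lemma componentwise_subadditive_bounded (R : realType) (n : nat)
    (f : ('I_n.+1 -> R) -> R) (a b : 'I_n.+1 -> R) :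
  lebesgue_measurable_fun (@orthant R n.+1) f ->
  componentwise_subadditive (fun=> @pos_reals R) f ->
  orthant a -> (forall i, a i <= b i) ->
  exists M, forall t, (forall i, a i <= t i <= b i) -> f t <= M.
Proof.
move=> fmeas fsub a0 ab; set d := n.+1 in f a b fmeas fsub a0 ab *.
set mu := @lebesgue_outer_measure R n.+1.
pose X := [set x : 'I_d -> R | forall i, 0 < x i < b i].
pose D k : set ('I_d -> R) :=
  @orthant R d `&` f @^-1` `[k%:R, k.+1%:R[%classic.
have mD k : mu.-caratheodory (D k).
  by apply: fmeas; exact: measurable_itv.
have tD : trivIset setT D.
  move=> k l _ _ [x [[_ +] [_ +]]]; rewrite /= !in_itv/=.
  move=> /andP[kx xk] /andP[lx xl].
  have := le_lt_trans kx xl; have := le_lt_trans lx xk.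
  by rewrite !ltr_nat !ltnS => lk kl; apply/eqP; rewrite eqn_leq kl lk.
have muX : (mu X < +oo)%E.
  apply: (@le_lt_trans _ _ (\prod_(i < n.+1) (b i - 0))%:E); last exact: ltry.
  apply: (@le_trans _ _ (mu (closed_box (fun=> 0) b))).
    apply: le_lebesgue_outer_measure => x xb i; have := xb i.
    by rewrite /= in_itv/= => /andP[/ltW -> /ltW ->].
  apply: lebesgue_outer_measure_closed_box => i.
  by rewrite (le_trans _ (ab i))// ltW// a0.
have c0 : 0 < \prod_(i < d) a i by apply: prodr_gt0 => i _; exact: a0.
have p0 : 0 < (2 : R) ^+ d by rewrite exprn_gt0.
have [N muN] := caratheodory_tail_lt mD tD muX (divr_gt0 c0 p0).
exists (2 ^+ d * N%:R) => t tab; rewrite leNgt; apply/negP => ft.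
set A := X `&` _ in muN.
have : ((\prod_(i < d) a i)%:E <= (2 ^+ d)%:E * mu A)%E.
  apply: (le_trans (lebesgue_outer_measure_open_box (fun i => ltW (a0 i)))).
  rewrite -[X in 2 ^+ X]card_ord cardE.
  apply: le_trans (lebesgue_outer_measure_corner t _ A).
  apply: le_lebesgue_outer_measure => x xa.
  have xt i : 0 < x i < t i.
    by have := xa i; have := tab i; lra.
  have [z [zE _ ftz]] :=
    componentwise_subadditive_corner fsub (enum_uniq 'I_d) xt.
  have zt i : 0 < z i < t i.
    by have [|->|->] := zE i; rewrite ?mem_enum//; have := xt i; lra.
  exists z => [i|]; first by rewrite mem_enum; apply: zE; rewrite mem_enum.
  have Nz : N%:R < f z.
    rewrite -cardE card_ord in ftz.
    by rewrite -(ltr_pM2l p0) (lt_le_trans ft).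
  split; first by move=> i; have := zt i; have := tab i; lra.
  have z0 : 0 <= f z by rewrite (le_trans _ (ltW Nz)).
  exists (Num.truncn (f z)).
    by rewrite /=; apply/negP; rewrite -leqNgt truncn_ge_nat// ltW.
  split; first by move=> i; have /andP[] := zt i.
  by rewrite /= in_itv/= truncn_itv.
apply/negP; rewrite -ltNge.
have -> : \prod_(i < d) a i = 2 ^+ d * (\prod_(i < d) a i / 2 ^+ d).
  by rewrite mulrC divfK// gt_eqF.
by rewrite EFinM lte_pmul2l.
Qed.

(** * Growth of the quotient *)

(** One copy of y fewer is taken out of x than in Euclidean division, so that
the remainder z is at least y: a subadditive function may be unbounded near
0. *)
Lemma subadditive_on_euclid (R : realType) (g : R -> R) (x y : R) :
  subadditive_on (@pos_reals R) g -> 0 < y -> y <= x ->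
  exists (n : nat) (z : R),
    [/\ x = n%:R * y + z, y <= z <= 2 * y & g x <= n%:R * g y + g z].
Proof.
move=> gsub y0 yx; pose n := (Num.truncn (x / y)).-1.
have xy1 : 1 <= x / y by rewrite ler_pdivlMr// mul1r.
have tgt0 : (0 < Num.truncn (x / y))%N by rewrite truncn_gt0.
have /andP[lo hi] : (n.+1)%:R <= x / y < (n.+2)%:R.
  by rewrite /n prednK// truncn_itv// (le_trans ler01).
rewrite ler_pdivlMr// in lo; rewrite ltr_pdivrMr// in hi.
exists n, (x - n%:R * y); split; first by ring.
  by rewrite -!natr1 in lo hi; nra.
have : y <= x - n%:R * y by rewrite -natr1 in lo; nra.
set z := x - _ => yz; have -> : x = n%:R * y + z by rewrite /z; ring.
have z0 : 0 < z by lra.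
clearbody z n => {x yx xy1 tgt0 lo hi yz}.
elim: n => [|n IHn]; first by rewrite !mul0r !add0r.
have nyz : 0 < n%:R * y + z by rewrite ltr_wpDl// mulr_ge0// ltW.
have := gsub _ _ y0 nyz; rewrite -natr1 !mulrDl !mul1r.
by rewrite addrA [y + _]addrC; lra.
Qed.

(** The real-valued form of [quot_prod], for computing without extended
reals: [quot_prod f x] is convertible to [(density f x)%:E]. *)
Definition density (R : realType) (d : nat) (f : ('I_d -> R) -> R)
  (x : 'I_d -> R) : R := f x / \prod_(i < d) x i.

Lemma orthant_dfwith (R : realType) (d : nat) (x : 'I_d -> R) (i : 'I_d)
  (t : R) : orthant x -> 0 < t -> orthant (dfwith x i t).
Proof. by move=> x0 t0 j; rewrite dfwithE; case: ifP => // _; exact: x0. Qed.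

(** With x_i = n y + z, dividing f x <= n f(..y..) + f(..z..) by the product of
the coordinates gives the weights n y / x_i and z / x_i, of sum 1.  The bound
on the second weight w is what makes the z-term negligible for x_i large. *)
Lemma density_convex (R : realType) (d : nat) (f : ('I_d -> R) -> R)
    (x : 'I_d -> R) (i : 'I_d) (y : R) :
  componentwise_subadditive (fun=> @pos_reals R) f -> orthant x ->
  0 < y -> y <= x i ->
  exists z w : R, [/\ y <= z <= 2 * y, 0 <= w <= 1, w <= 2 * (y / x i) &
    density f x <= (1 - w) * density f (dfwith x i y) +
                    w * density f (dfwith x i z)].
Proof.
move=> fsub x0 y0 yx.
have gsub := fsub i x (fun j _ => x0 j).
have [n [z [xE /andP[yz z2y]]]] := subadditive_on_euclid gsub y0 yx.
rewrite (_ : dfwith x i (x i) = x); last first.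
  by apply/funext => j; rewrite dfwithE; case: eqVneq => // ->.
move=> fx; have xi0 : 0 < x i by exact: x0.
have z0 : 0 < z by exact: lt_le_trans yz.
have n0 : 0 <= n%:R * y :> R by rewrite mulr_ge0// ltW.
pose P := \prod_(j < d | j != i) x j.
have P0 : 0 < P by apply: prodr_gt0 => j _; exact: x0.
have prodE u : \prod_(j < d) dfwith x i u j = u * P.
  rewrite (bigD1 i)//= dfwithin; congr (_ * _); apply: eq_bigr => j ji.
  by rewrite dfwithout// eq_sym.
exists z, (z / x i); split; first by rewrite yz.
- by rewrite divr_ge0 ?(ltW z0) ?(ltW xi0)//= ler_pdivrMr// mul1r xE lerDr.
- by rewrite mulrA ler_pM2r// invr_gt0.
rewrite /density !prodE (bigD1 i)//= -/P.
have -> : (1 - z / x i) * (f (dfwith x i y) / (y * P)) +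
    z / x i * (f (dfwith x i z) / (z * P)) =
    (n%:R * f (dfwith x i y) + f (dfwith x i z)) / (x i * P).
  have -> : (n%:R : R) = (x i - z) / y by rewrite xE addrK mulfK// gt_eqF.
  by field; rewrite !gt_eqF.
by rewrite ler_pM2r// invr_gt0 mulr_gt0.
Qed.

(** A convex combination is at most the larger of the two values, so each
coordinate of x can in turn be brought into [y_i, 2 y_i] without decreasing the
density. *)
Lemma density_le_box (R : realType) (d : nat) (f : ('I_d -> R) -> R)
    (y : 'I_d -> R) (M : R) :
  componentwise_subadditive (fun=> @pos_reals R) f -> orthant y ->
  (forall x, (forall i, y i <= x i <= 2 * y i) -> density f x <= M) ->
  forall x, le_prod y x -> density f x <= M.
Proof.
move=> fsub y0 yM x yx.
have xs i : i \notin enum 'I_d -> x i <= 2 * y i by rewrite mem_enum.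
elim: (enum 'I_d) => [|i s IHs] in x yx xs *.
  by apply: yM => i; rewrite yx xs.
have x0 j : 0 < x j by exact: lt_le_trans (y0 j) (yx j).
have [z [w [/andP[yz zy] /andP[w0 w1] _]]] :=
  density_convex fsub x0 (y0 i) (yx i).
have qM u : y i <= u -> u <= 2 * y i -> density f (dfwith x i u) <= M.
  move=> yu uy; apply: IHs => j; rewrite dfwithE; case: eqVneq => [<-//|ij].
    exact: yx.
  by move=> js; apply: xs; rewrite inE eq_sym negb_or ij.
have := qM _ (lexx _); have := qM _ yz zy; have := y0 i; rewrite /pos_reals/=.
by move=> yi0 qz /(_ ltac:(lra)) qy; nra.
Qed.

(** Replacing x_i by y_i costs at most w (M - q y), with w <= 2 y_i / x_i the
weight of the other value, itself at most M.  It is important that M - q y, and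
not M - q at the intermediate point, appears here: q may be arbitrarily
negative at the latter. *)
Lemma density_le_near (R : realType) (d : nat) (f : ('I_d -> R) -> R)
    (y : 'I_d -> R) (M : R) :
  componentwise_subadditive (fun=> @pos_reals R) f -> orthant y ->
  (forall x, le_prod y x -> density f x <= M) ->
  forall (s : seq 'I_d) (x : 'I_d -> R), uniq s -> le_prod y x ->
    (forall i, i \notin s -> x i = y i) ->
    density f x <= density f y +
      2 * (M - density f y) * \sum_(i <- s) y i / x i.
Proof.
move=> fsub y0 yM; have qyM : density f y <= M by apply: yM => i.
elim=> [|i s IHs] x /=.
  move=> _ _ xy; rewrite big_nil mulr0 addr0 (_ : x = y)//.
  by apply/funext => j; exact: xy.
move=> /andP[iNs us] yx xs.
have x0 j : 0 < x j by exact: lt_le_trans (y0 j) (yx j).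
have [z [w [/andP[yz zy] /andP[w0 w1] wy qx]]] :=
  density_convex fsub x0 (y0 i) (yx i).
have qz : density f (dfwith x i z) <= M.
  by apply: yM => j; rewrite dfwithE; case: eqVneq => // <-.
have : density f (dfwith x i (y i)) <= density f y +
      2 * (M - density f y) * \sum_(j <- s) y j / x j.
  have -> : \sum_(j <- s) y j / x j =
      \sum_(j <- s) y j / dfwith x i (y i) j.
    apply: eq_big_seq => j js; rewrite dfwithout//.
    by apply: contraNneq iNs => ->.
  apply: IHs => // j; rewrite dfwithE; case: eqVneq => [<-//|ij].
    exact: yx.
  by move=> js; apply: xs; rewrite inE eq_sym negb_or ij.
have : 0 <= \sum_(j <- s) y j / x j.
  by apply: sumr_ge0 => j _; rewrite divr_ge0// ltW//; exact: y0.
rewrite big_cons; move: (\sum_(j <- s) _) => S S0 qy.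
move: (y i / x i) wy qx => r wr qx.
(* The value at the point with x_i replaced by y_i enters only through its
   upper bound from the induction hypothesis, which is at least a. *)
set a := density f y in qyM qy *.
have {}qx : density f x <= (1 - w) * (a + 2 * (M - a) * S) + w * M.
  apply: (le_trans qx); apply: lerD; apply: ler_wpM2l => //.
  by rewrite subr_ge0.
apply: (le_trans qx).
have Ma : 0 <= M - a by rewrite subr_ge0.
have := mulr_ge0 (mulr_ge0 Ma S0) w0.
have : w * (M - a) <= 2 * r * (M - a) by exact: ler_wpM2r.
by lra.
Qed.

(** The constant C depends on y only, which makes this a statement about all
coordinates of x being large at once (s the full list) as well as about a single
coordinate moving away from y (s a singleton). *)
Lemma density_approx (R : realType) (n : nat) (f : ('I_n.+1 -> R) -> R)
    (y : 'I_n.+1 -> R) :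
  lebesgue_measurable_fun (@orthant R n.+1) f ->
  componentwise_subadditive (fun=> @pos_reals R) f -> orthant y ->
  exists2 C, 0 <= C &
    forall (s : seq 'I_n.+1) (x : 'I_n.+1 -> R), uniq s -> le_prod y x ->
      (forall i, i \notin s -> x i = y i) ->
      density f x <= density f y + C * \sum_(i <- s) y i / x i.
Proof.
move=> fmeas fsub y0.
have y2 i : y i <= 2 * y i by have := y0 i; rewrite /pos_reals/=; lra.
have [M fM] := componentwise_subadditive_bounded fmeas fsub y0 y2.
(* The maximum with 0 lets the bound on f survive division by products of
   varying size. *)
pose M' := Num.max 0 M / \prod_(i < n.+1) y i.
have qM' x : (forall i, y i <= x i <= 2 * y i) -> density f x <= M'.
  move=> xy; have /fM fxM := xy.
  have yprod0 : 0 < \prod_(i < n.+1) y i.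
    by apply: prodr_gt0 => i _; exact: y0.
  have yxprod : \prod_(i < n.+1) y i <= \prod_(i < n.+1) x i.
    apply: ler_prod => i _; have /andP[-> _] := xy i.
    by rewrite ltW//; exact: y0.
  apply: (@le_trans _ _ (Num.max 0 M / \prod_(i < n.+1) x i)).
    rewrite /density ler_pM2r ?invr_gt0 ?(lt_le_trans yprod0)//.
    by rewrite le_max fxM orbT.
  rewrite ler_wpM2l ?le_max ?lexx//.
  by rewrite lef_pV2// posrE (lt_le_trans yprod0).
have qM := density_le_box fsub y0 qM'.
exists (2 * (M' - density f y)); last exact: density_le_near.
by rewrite mulr_ge0// subr_ge0; apply: qM => i.
Qed.

(** * Limits *)
Lemma cvg_ereal_of_bounds (R : realType) (T : Type) (F : set_system T)
    (FF : Filter F) (h : T -> \bar R) (l : \bar R) : (l < +oo)%E ->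
  (\forall t \near F, (l <= h t)%E) ->
  (forall u : R, (l < u%:E)%E -> \forall t \near F, (h t <= u%:E)%E) ->
  h t @[t --> F] --> l.
Proof.
case: l => [r| |] // _ lh hu; last first.
  by apply/cvgeNyPle => u; apply: hu; exact: ltNyr.
have hfin : \forall t \near F, h t \is a fin_num.
  near=> t; rewrite fin_numElt; apply/andP; split.
    by apply: (@lt_le_trans _ _ r%:E); [exact: ltNyr|near: t].
  apply: (@le_lt_trans _ _ (r + 1)%:E); last exact: ltry.
  by near: t; apply: hu; rewrite lte_fin ltrDl.
apply/fine_cvgP; split => //; apply/cvgrPdist_le => eps eps0.
near=> t.
have : (r%:E <= h t)%E by near: t.
have : (h t <= (r + eps)%:E)%E by near: t; apply: hu; rewrite lte_fin ltrDl.
have /fineK <- : h t \is a fin_num by near: t.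
by rewrite !lee_fin /= ler_distlC => h1 h2; lra.
Unshelve. all: by end_near. Qed.

Lemma quot_prod_dir_lim (R : realType) (n : nat) (f : ('I_n.+1 -> R) -> R) :
  lebesgue_measurable_fun (@orthant R n.+1) f ->
  componentwise_subadditive (fun=> @pos_reals R) f ->
  is_dir_lim (@orthant R n.+1) (@le_prod R n.+1) (quot_prod f)
    (ereal_inf [set quot_prod f x | x in @orthant R n.+1]).
Proof.
move=> fmeas fsub; set L := ereal_inf _.
set U := @orthant R n.+1; set le := @le_prod R n.+1; set q := quot_prod f.
have Linf : (L <= dir_liminf U le q)%E.
  apply: (@le_trans _ _
    (ereal_inf [set q y | y in [set y | U y /\ le (fun=> 1) y]])).
    by apply: le_ereal_inf => _ [y [Uy _] <-]; exists y.
  apply: ereal_sup_ubound; exists (fun=> 1) => // i.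
  exact: ltr01.
have infsup : (dir_liminf U le q <= dir_limsup U le q)%E.
  apply: ge_ereal_sup => _ [x Ux <-]; apply: le_ereal_inf_tmp => _ [y Uy <-].
  pose z i := Num.max (x i) (y i).
  have Uz : U z by move=> i; rewrite /pos_reals/= lt_max Ux.
  apply: (@le_trans _ _ (q z)).
    apply: ereal_inf_lbound; exists z => //; split=> // i.
    by rewrite le_max lexx.
  apply: ereal_sup_ubound; exists z => //; split=> // i.
  by rewrite le_max lexx orbT.
have supL : (dir_limsup U le q <= L)%E.
  apply: le_ereal_inf_tmp => _ [y Uy <-].
  have [C C0 qC] := density_approx fmeas fsub Uy.
  apply/lee_addgt0Pr => eps eps0.
  (* Beyond K y each ratio y_i / x_i is at most 1 / K, and C d / K <= eps. *)
  pose K := 1 + C * n.+1%:R / eps.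
  have K1 : 1 <= K by rewrite lerDl divr_ge0 ?mulr_ge0// ltW.
  have K0 : 0 < K by rewrite (lt_le_trans _ K1).
  pose X i := K * y i.
  apply: (@le_trans _ _
    (ereal_sup [set q x | x in [set x | U x /\ le X x]])).
    apply: ereal_inf_lbound; exists X => // i.
    by rewrite /pos_reals/= mulr_gt0//; exact: Uy.
  apply: ge_ereal_sup => _ [x [Ux Xx] <-].
  have yx : le_prod y x.
    move=> i; apply: le_trans (Xx i); rewrite /X ler_peMl//.
    by rewrite ltW//; exact: Uy.
  have xy i : i \notin enum 'I_n.+1 -> x i = y i by rewrite mem_enum.
  rewrite -EFinD lee_fin; apply: (le_trans (qC _ x (enum_uniq _) yx xy)).
  rewrite lerD2l; apply: (@le_trans _ _ (C * \sum_(i <- enum 'I_n.+1) K^-1)).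
    rewrite ler_wpM2l// ler_sum// => i _.
    rewrite ler_pdivrMr; last exact: Ux.
    by rewrite ler_pdivlMl//; exact: Xx.
  rewrite big_enum sumr_const card_ord -mulr_natl mulrA.
  rewrite ler_pdivrMr// /K mulrDr mulr1 mulrCA mulfV ?gt_eqF// mulr1.
  by rewrite lerDr ltW.
split; apply/le_anti; rewrite ?Linf ?supL ?(le_trans Linf)//.
by rewrite (le_trans infsup).
Qed.

(** The value of the iterated limit over the coordinates in s: the infimum over
these coordinates, the others being fixed to those of x. *)
Definition slice_inf (R : realType) (d : nat) (q : ('I_d -> R) -> \bar R)
    (s : seq 'I_d) (x : 'I_d -> R) : \bar R :=
  ereal_inf [set q y | y in
    [set y | orthant y /\ forall j, j \notin s -> y j = x j]].

(** The infimum over i :: s is the infimum over t of the infima over s at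
x_i = t, hence a lower bound of all of them.  Conversely, if a point y has
q y < u, moving its i-th coordinate to a large t keeps q at most u, and the moved
point competes in the infimum over s at x_i = t. *)
Lemma quot_prod_iterated_lim (R : realType) (n : nat)
    (f : ('I_n.+1 -> R) -> R) (s : seq 'I_n.+1) (x : 'I_n.+1 -> R) :
  lebesgue_measurable_fun (@orthant R n.+1) f ->
  componentwise_subadditive (fun=> @pos_reals R) f ->
  (forall j, j \notin s -> 0 < x j) ->
  is_iterated_lim s (quot_prod f) x (slice_inf (quot_prod f) s x).
Proof.
move=> fmeas fsub; elim: s x => [|i s IHs] x x0 /=.
  rewrite /slice_inf (_ : [set _ | _ in _] = [set quot_prod f x]) ?ereal_inf1//.
  apply/seteqP; split => [_ [y [_ yx] <-]|_ ->].
    by rewrite (_ : y = x)//; apply/funext => j; exact: yx.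
  by exists x => //; split => // j; exact: x0.
have lfin : (slice_inf (quot_prod f) (i :: s) x < +oo)%E.
  pose y j := if j \in i :: s then 1 else x j.
  apply: (@le_lt_trans _ _ (quot_prod f y)); last exact: ltry.
  apply: ereal_inf_lbound; exists y => //; split.
    by move=> j; rewrite /y /pos_reals/=; case: ifPn => // /x0.
  by move=> j /negbTE js; rewrite /y js.
split => //; exists (fun t => slice_inf (quot_prod f) s (dfwith x i t)); split.
  move=> t t0; apply: IHs => j js; rewrite dfwithE; case: eqVneq => // ij.
  by apply: x0; rewrite inE eq_sym negb_or ij.
apply: cvg_ereal_of_bounds => //.
  apply: nearW => t; apply: le_ereal_inf => _ [y [y0 yx] <-].
  exists y => //; split => // j; rewrite inE eq_sym negb_or => /andP[ij js].
  by rewrite yx// dfwithout.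
move=> u /ereal_inf_lt[_ [y [y0 yx] <-]]; rewrite lte_fin => yu.
have [C C0 qC] := density_approx fmeas fsub y0.
have yi0 : 0 < y i by exact: y0.
have uy0 : 0 < u - density f y by rewrite subr_gt0.
near=> t.
have yt : y i <= t by near: t; apply: nbhs_pinfty_ge; rewrite num_real.
have Ct : C * y i / (u - density f y) <= t.
  by near: t; apply: nbhs_pinfty_ge; rewrite num_real.
apply: (@le_trans _ _ (quot_prod f (dfwith y i t))).
  apply: ereal_inf_lbound; exists (dfwith y i t) => //; split.
    by apply: orthant_dfwith => //; exact: lt_le_trans yt.
  move=> j js; rewrite !dfwithE; case: eqVneq => // ij.
  by apply: yx; rewrite inE eq_sym negb_or ij.
rewrite lee_fin; apply: (le_trans (qC [:: i] (dfwith y i t) _ _ _)) => //.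
- by move=> j; rewrite dfwithE; case: eqVneq => // <-.
- by move=> j; rewrite inE => ij; rewrite dfwithout// eq_sym.
rewrite big_seq1 dfwithin -lerBrDl mulrA ler_pdivrMr ?(lt_le_trans yi0)//.
by move: Ct; rewrite ler_pdivrMr// [t * _]mulrC.
Unshelve. all: by end_near. Qed.

Theorem theorem5p1 (R : realType) (d : nat) (hd : (1 <= d)%N)
    (f : ('I_d -> R) -> R)
    (fmeas : lebesgue_measurable_fun (@orthant R d) f)
    (fsub : componentwise_subadditive (fun=> @pos_reals R) f) :
  exists L : \bar R,
    [/\ (L < +oo)%E,
        is_dir_lim (@orthant R d) (@le_prod R d) (quot_prod f) L,
        L = ereal_inf [set quot_prod f x | x in @orthant R d] &
        forall (sigma : {perm 'I_d}) (x : 'I_d -> R),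
          is_iterated_lim [seq sigma i | i <- enum 'I_d] (quot_prod f) x L].
Proof.
case: d => [//|n] in hd f fmeas fsub *.
exists (ereal_inf [set quot_prod f x | x in @orthant R n.+1]); split => //.
- apply: (@le_lt_trans _ _ (quot_prod f (fun=> 1))); last exact: ltry.
  by apply: ereal_inf_lbound; exists (fun=> 1) => // i; exact: ltr01.
- exact: quot_prod_dir_lim.
move=> sigma x; set s := map _ _.
have sT j : j \in s.
  by apply/mapP; exists (sigma^-1%g j); rewrite ?mem_enum ?permKV.
rewrite (_ : ereal_inf _ = slice_inf (quot_prod f) s x); last first.
  congr ereal_inf; apply/seteqP; split => [_ [y y0 <-]|_ [y [y0 _] <-]].
    by exists y => //; split => // j; rewrite sT.
  by exists y.
by apply: quot_prod_iterated_lim => // j; rewrite sT.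
Qed.
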